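(* Let $(E,d)$ be a Polish space, $p>1$ and $\mu\in(0,1)$. There is a constant $C>0$ such that for every $f\in D^{\mu}([0,1],E)$, \[ [f]_{\mu}+|f]_{\mu}+[f|_{\mu}\le C\left([[f]]_{\mu,p}+||f]]_{\mu,p}+[[f||_{\mu,p}\right). \] Moreover, if $E=\mathbf{R}^{d}$ with $d(x,y)=|x-y|$, then for every $f\in D^{\mu}([0,1],\mathbf{R}^d)$, \[ \sup_{0\le t\le 1}|f(t)|\le C\left(|f|_{L_p([0,1])}+[[f]]_{\mu,p}+||f]]_{\mu,p}+[[f||_{\mu,p}\right). \]
   Context: $D([0,1],E)$ denotes the space of $E$-valued càdlàg functions on $[0,1]$. For $0\le s\le t\le u\le 1$, $\Delta(f;s,t,u)=d(f(s),f(t))\wedge d(f(t),f(u))$. For $\mu\in(0,1)$, $[f]_{\mu}=\sup_{0\le s\le t\le u\le 1}\frac{\Delta(f;s,t,u)}{|u-s|^{\mu}}$, $|f]_{\mu}=\sup_{t\in(0,1]}\frac{d(f(0),f(t))}{t^{\mu}}$, $[f|_{\mu}=\sup_{t\in[0,1)}\frac{d(f(1),f(t))}{|1-t|^{\mu}}$, and $D^{\mu}([0,1],E)$ is the set of $f\in D([0,1],E)$ with $[f]_\mu+|f]_\mu+[f|_\mu<\infty$. For $p>1$: $[[f]]_{\mu,p}=\left(\iiint_{0\le s<t<u\le 1}\frac{\Delta(f;s,t,u)^{p}}{|u-s|^{\mu p+3}}\,ds\,dt\,du\right)^{1/p}$, $||f]]_{\mu,p}=\left(\int_0^1\frac{d(f(0),f(t))^{p}}{t^{\mu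 p+1}}dt\right)^{1/p}$, $[[f||_{\mu,p}=\left(\int_0^1\frac{d(f(1),f(t))^{p}}{|1-t|^{\mu p+1}}dt\right)^{1/p}$. *)

(* Defs.v *)
From HB Require Import structures.
From mathcomp Require Import all_boot all_order all_algebra.
From mathcomp Require Import all_classical all_reals all_analysis.
Set Implicit Arguments. Unset Strict Implicit. Unset Printing Implicit Defensive.
Import Order.TTheory GRing.Theory Num.Theory.
Local Open Scope classical_set_scope.
Local Open Scope ring_scope.

Section Defs.
Context {R : realType} {E : Type} (dist : E -> E -> R).

Definition is_metric : Prop :=
  [/\ forall x y, 0 <= dist x y,
      forall x y, dist x y = 0 <-> x = y,
      forall x y, dist x y = dist y x &
      forall x y z, dist x z <= dist x y + dist y z].

Definition is_polish : Prop :=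
  [/\ is_metric,
      (forall x : nat -> E,
         (forall e, 0 < e -> exists N, forall m n, (N <= m)%N -> (N <= n)%N ->
            dist (x m) (x n) < e) ->
         exists l, forall e, 0 < e -> exists N, forall n, (N <= n)%N ->
            dist (x n) l < e) &
      exists S : set E, countable S /\
        forall y e, 0 < e -> exists x, S x /\ dist x y < e].

(** f : [0,1] -> E is càdlàg (we only look at f on [0,1]) *)
Definition cadlag (f : R -> E) : Prop :=
  (forall t, 0 <= t < 1 -> forall e, 0 < e -> exists2 dl, 0 < dl &
     forall s, t <= s -> s <= 1 -> s < t + dl -> dist (f s) (f t) < e) /\
  (forall t, 0 < t <= 1 -> exists l : E, forall e, 0 < e -> exists2 dl, 0 < dl &
     forall s, 0 <= s -> s < t -> t - dl < s -> dist (f s) l < e).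

Definition Delta (f : R -> E) (s t u : R) : R :=
  Num.min (dist (f s) (f t)) (dist (f t) (f u)).

(** [f]_mu  (pairs with s = u give Delta = 0 and are omitted) *)
Definition holder_mid (f : R -> E) (mu : R) : \bar R :=
  ereal_sup [set x | exists s t u, [/\ 0 <= s, s <= t <= u, s < u, u <= 1
     & x = ((Delta f s t u) / (u - s) `^ mu)%:E]].

Definition holder_left (f : R -> E) (mu : R) : \bar R :=
  ereal_sup [set (dist (f 0) (f t) / t `^ mu)%:E | t in `]0, 1]].

Definition holder_right (f : R -> E) (mu : R) : \bar R :=
  ereal_sup [set (dist (f 1) (f t) / (1 - t) `^ mu)%:E | t in `[0, 1[].

Definition Dmu (f : R -> E) (mu : R) : Prop :=
  [/\ cadlag f, holder_mid f mu < +oo, holder_left f mu < +oo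
    & holder_right f mu < +oo]%E.

Local Notation leb := (@lebesgue_measure R).

(** [[f]]_{mu,p} ; the triple integral over 0 <= s < t < u <= 1 as an
    iterated Lebesgue integral of a nonnegative function (du dt ds order
    irrelevant by Tonelli) *)
Definition besov_mid (f : R -> E) (mu p : R) : \bar R :=
  ((\int[leb]_(u in `[0%R, 1%R]) \int[leb]_(t in `[0%R, 1%R]) \int[leb]_(s in `[0%R, 1%R])
      (if ((s < t) && (t < u))%R then
         ((Delta f s t u) `^ p / (u - s) `^ (mu * p + 3))%:E else 0%E))
   `^ p^-1)%E.

Definition besov_left (f : R -> E) (mu p : R) : \bar R :=
  ((\int[leb]_(t in `[0%R, 1%R]) (dist (f 0) (f t) `^ p / t `^ (mu * p + 1))%:E)
   `^ p^-1)%E.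

Definition besov_right (f : R -> E) (mu p : R) : \bar R :=
  ((\int[leb]_(t in `[0%R, 1%R])
      (dist (f 1) (f t) `^ p / (1 - t) `^ (mu * p + 1))%:E) `^ p^-1)%E.

End Defs.

Definition enorm {R : realType} {d : nat} (x : 'rV[R]_d) : R :=
  Num.sqrt (\sum_(i < d) (x ord0 i) ^+ 2).

Definition eucl_dist {R : realType} {d : nat} (x y : 'rV[R]_d) : R := enorm (x - y).

Definition Lp_norm {R : realType} {d : nat} (f : R -> 'rV[R]_d) (p : R) : \bar R :=
  ((\int[@lebesgue_measure R]_(t in `[0%R, 1%R]) (enorm (f t) `^ p)%:E) `^ p^-1)%E.

Definition sup_norm {R : realType} {d : nat} (f : R -> 'rV[R]_d) : \bar R :=
  ereal_sup [set (enorm (f t))%:E | t in `[0%R, 1%R]].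

(* Main.v *)
Require Import Defs.
From HB Require Import structures.
From mathcomp Require Import all_boot all_order all_algebra.
From mathcomp Require Import all_classical all_reals all_analysis.
From mathcomp Require Import ring lra.
Import Order.TTheory GRing.Theory Num.Theory.
Local Open Scope classical_set_scope.
Local Open Scope ring_scope.

(** Let G be the largest of the three Hölder seminorms, which is finite as f is
    in D^mu.  For x in [0,1] and a small h, either every y in [x-h,x] or every y
    in [x,x+h] satisfies d(f x, f y) <= 2G(2h)^mu: two points violating this on
    opposite sides of x would contradict the bound on Delta, while within h of
    an endpoint the one-sided seminorms decide.  So a point, or triple of points,
    that nearly attains G on the scale h can be thickened to intervals of length
    proportional to h on which the Besov integrand is at least c G^p h^-1
    (respectively c G^p h^-3), whence c' G^p is at most the corresponding
    integral.  Integrals are bounded below without measurability, since the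
    integral of a nonnegative function is a supremum over simple functions. *)

(** * Lower bounds for integrals without measurability *)

(** A simple function below [f] extended by zero off [D] is also below [g] extended by zero off
    [D'], so the second supremum runs over more functions. *)
Lemma le_integral_nonmeasurable d (T : measurableType d) (R : realType)
    (m : {measure set T -> \bar R}) (D D' : set T) (f g : T -> \bar R) :
  D `<=` D' -> (forall x, D x -> 0 <= f x)%E -> (forall x, D' x -> 0 <= g x)%E ->
  (forall x, D x -> f x <= g x)%E ->
  (\int[m]_(x in D) f x <= \int[m]_(x in D') g x)%E.
Proof.
move=> DD' f0 g0 fg; rewrite !ge0_integralE//.
apply: ge_ereal_sup => _ [h/= hf <-]; apply: ereal_sup_ubound; exists h => //= x.
apply: le_trans (hf x) _; rewrite /patch; case: ifPn => [|_].
  by rewrite inE => Dx; rewrite mem_set; [exact: fg|exact: DD'].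
by case: ifPn => //; rewrite inE => /g0.
Qed.

Lemma integral_ge_itv (R : realType) (D : set R) (g : R -> \bar R) (a h c : R) :
  0 <= c -> 0 <= h -> `[a, a + h]%classic `<=` D ->
  (forall x, D x -> 0 <= g x)%E ->
  (forall x, a <= x <= a + h -> (c%:E <= g x)%E) ->
  ((c * h)%:E <= \int[@lebesgue_measure R]_(x in D) g x)%E.
Proof.
move=> c0 h0 sub g0 cg.
have -> : (c * h)%:E = (\int[@lebesgue_measure R]_(x in `[a, (a + h)%R]) c%:E)%E.
  rewrite integral_cst//= lebesgue_measure_itv/= lte_fin.
  rewrite EFinM; congr (_ * _)%E; case: ltP => h'; first by rewrite -EFinD; congr EFin; lra.
  by congr EFin; lra.
by apply: le_integral_nonmeasurable => // x /=; rewrite in_itv/=; exact: cg.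
Qed.

(** * Oscillation on short windows *)

(** By the triangle inequality each of the two distances drops by at most [2 * e], hence so does
    their minimum. *)
Lemma Delta_ge (R : realType) (E : Type) (dist : E -> E -> R) (f : R -> E)
    (s t u s' t' u' e : R) : is_metric dist ->
  dist (f s) (f s') <= e -> dist (f t) (f t') <= e -> dist (f u) (f u') <= e ->
  Delta dist f s t u - 2 * e <= Delta dist f s' t' u'.
Proof.
move=> [_ _ dC dT] hs ht hu; rewrite /Delta le_min.
have h1 : Num.min (dist (f s) (f t)) (dist (f t) (f u)) <= dist (f s) (f t).
  by rewrite ge_min lexx.
have h2 : Num.min (dist (f s) (f t)) (dist (f t) (f u)) <= dist (f t) (f u).
  by rewrite ge_min lexx orbT.
have := dT (f s) (f s') (f t); have := dT (f s') (f t') (f t).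
have := dT (f t) (f t') (f u); have := dT (f t') (f u') (f u).
rewrite (dC (f t') (f t)) (dC (f u') (f u)).
by move=> *; apply/andP; split; lra.
Qed.

(** The bounds are multiplied out, with a real [G], so that they also cover the degenerate cases
    [s = u], [t = 0] and [t = 1] left out of the suprema. *)
Definition holder_bounded (R : realType) (E : Type) (dist : E -> E -> R)
    (f : R -> E) (mu G : R) : Prop :=
  [/\ forall s t u, 0 <= s -> s <= t <= u -> u <= 1 ->
        Delta dist f s t u <= G * (u - s) `^ mu,
      forall t, 0 <= t <= 1 -> dist (f 0) (f t) <= G * t `^ mu
    & forall t, 0 <= t <= 1 -> dist (f 1) (f t) <= G * (1 - t) `^ mu].

Lemma almost_constant_window (R : realType) (E : Type) (dist : E -> E -> R)
    (f : R -> E) (mu G x h : R) :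
  is_metric dist -> 0 < mu -> 0 <= G -> holder_bounded R E dist f mu G ->
  0 <= x <= 1 -> 0 < h -> 2 * h <= 1 ->
  exists a, [/\ 0 <= a, a + h <= 1, a <= x <= a + h &
    forall y, a <= y <= a + h -> dist (f x) (f y) <= 2 * G * (2 * h) `^ mu].
Proof.
move=> [d0 dE dC dT] mu0 G0 [Hm Hl Hr] /andP[x0 x1] h0 h1.
have mono y : 0 <= y -> y <= 2 * h -> G * y `^ mu <= G * (2 * h) `^ mu.
  by move=> y0 yh; apply: ler_wpM2l => //; apply: ge0_ler_powR; rewrite ?nnegrE; lra.
(* Here [x] and [y] both lie within [2 * h] of 0; passing through [f 0] costs two Hölder terms,
   whence the factor 2 in the bound. *)
have [xh|xh] := leP x h.
  exists x; split; [lra|lra|lra|] => y /andP[xy yx].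
  have := dT (f x) (f 0) (f y); rewrite (dC (f x) (f 0)).
  have := Hl x; have := Hl y; have := mono x; have := mono y; lra.
have [xh'|xh'] := leP (1 - h) x.
  exists (x - h); split; [lra|lra|lra|] => y /andP[xy yx].
  have := dT (f x) (f 1) (f y); rewrite (dC (f x) (f 1)).
  have := Hr x; have := Hr y; have := mono (1 - x); have := mono (1 - y); lra.
have G2 : 0 <= G * (2 * h) `^ mu by rewrite mulr_ge0// powR_ge0.
have [all_left|] := pselect (forall y, x - h <= y <= x ->
    dist (f x) (f y) <= G * (2 * h) `^ mu).
  exists (x - h); split; [lra|lra|lra|] => y /andP[xy yx].
  by have := all_left y; lra.
(* Some y0 on the left is far from x, so Delta(y0,x,z) forces f z to be near f x. *)
move=> /existsNP[y0 /not_implyP[/andP[y0l y0r] /negP]]; rewrite -ltNge => bad.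
exists x; split; [lra|lra|lra|] => z /andP[xz zx].
have := Hm y0 x z; rewrite /Delta (dC (f y0)) ge_min.
move=> /(_ _ _ _)/orP; rewrite xz y0r => -[||||]//; [lra|lra| |].
  have := mono (z - y0); lra.
have := mono (z - y0); lra.
Qed.

(** * Power estimates and the choice of scale *)

(** The power [mu * p] of [h] cancels between numerator and denominator, which leaves [h ^- n]. The
    endpoint integrals take [n = 1], the triple integral [n = 3]. *)
Lemma powR_ratio_ge (R : realType) (p mu G h D v : R) (n : nat) :
  0 < p -> 0 < mu -> 0 <= G -> 0 < h -> 0 < v <= 2 * h -> G * h `^ mu / 4 <= D ->
  (4 `^ p * 2 `^ (mu * p + n%:R))^-1 * G `^ p / h ^+ n
    <= D `^ p / v `^ (mu * p + n%:R).
Proof.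
move=> p0 mu0 G0 h0 /andP[v0 vh] GD.
have GD0 : 0 <= G * h `^ mu / 4 by rewrite !mulr_ge0// ?powR_ge0.
have e0 : 0 <= mu * p + n%:R by rewrite addr_ge0 ?mulr_ge0// ltW.
apply: (@le_trans _ _ ((G * h `^ mu / 4) `^ p / (2 * h) `^ (mu * p + n%:R))).
  rewrite powRM ?mulr_ge0 ?powR_ge0// powRM ?powR_ge0// -powRrM.
  rewrite (@powRM _ 2 h) ?(ltW h0)// (@powRD _ h) ?(gt_eqF h0) ?implybT//.
  rewrite powR_mulrn ?(ltW h0)//.
  rewrite -[4^-1]powR_inv1// -powRrM mulN1r powRN.
  have h1 : h `^ (mu * p) != 0 by rewrite gt_eqF// powR_gt0.
  have h2 : h ^+ n != 0 by rewrite expf_neq0// gt_eqF.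
  have h3 : (4 : R) `^ p != 0 by rewrite gt_eqF// powR_gt0.
  have h4 : (2 : R) `^ (mu * p + n%:R) != 0 by rewrite gt_eqF// powR_gt0.
  by rewrite le_eqVlt; apply/orP; left; apply/eqP; field; rewrite h1 h2 h3 h4.
apply: ler_pM; rewrite ?invr_ge0 ?powR_ge0//.
  by apply: ge0_ler_powR; rewrite ?nnegrE ?(ltW p0)// (le_trans GD0 GD).
rewrite lef_pV2 ?posrE ?powR_gt0//; last lra.
by apply: ge0_ler_powR; rewrite ?nnegrE//; lra.
Qed.

(** On a window of length [delta * h] the oscillation is then at most
    [2 * G * h^mu / 16 = G * h^mu / 8]. As [delta] depends on [mu] alone, the final constant is
    independent of [E] and [f]. *)
Lemma exists_window_scale (R : realType) (mu : R) : 0 < mu ->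
  exists delta : R, [/\ 0 < delta, 4 * delta <= 1 & (2 * delta) `^ mu <= 16^-1].
Proof.
move=> mu0; exists (Num.min 4^-1 ((16^-1) `^ mu^-1 / 2)).
set a := _ `^ mu^-1.
have a0 : 0 < a by rewrite powR_gt0.
have m1 : Num.min 4^-1 (a / 2) <= 4^-1 by rewrite ge_min lexx.
have m2 : Num.min 4^-1 (a / 2) <= a / 2 by rewrite ge_min lexx orbT.
have m0 : 0 < Num.min 4^-1 (a / 2) by rewrite lt_min; apply/andP; split; lra.
split; [by []|lra|].
apply: (@le_trans _ _ (a `^ mu)).
  by apply: ge0_ler_powR; rewrite ?nnegrE; lra.
by rewrite /a -powRrM mulVf ?gt_eqF// powRr1.
Qed.

(** * Lower bounds for the Besov integrals *)

(** The pair [e], [w] treats both endpoints at once: [w] is the distance to [e], kept as a parameter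
    so that the integrand has the form [t] or [1 - t] of the definitions. *)
Lemma endpoint_integral_ge (R : realType) (E : Type) (dist : E -> E -> R)
    (f : R -> E) (p mu delta G e t : R) (w : R -> R) :
  is_metric dist -> 0 < p -> 0 < mu -> 0 <= G -> holder_bounded R E dist f mu G ->
  0 < delta -> 4 * delta <= 1 -> (2 * delta) `^ mu <= 16^-1 ->
  0 <= e <= 1 -> (forall x, 0 <= x <= 1 -> w x = `|x - e|) ->
  0 <= t <= 1 -> 0 < w t -> G / 2 <= dist (f e) (f t) / w t `^ mu ->
  ((delta / (4 `^ p * 2 `^ (mu * p + 1)) * G `^ p)%:E <=
   \int[@lebesgue_measure R]_(x in `[0%R, 1%R])
     (dist (f e) (f x) `^ p / w x `^ (mu * p + 1))%:E)%E.
Proof.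
move=> met p0 mu0 G0 hb dl0 dl4 dl16 e01 wE t01 wt0 Ge.
set h := w t in wt0 Ge *.
have h1 : h <= 1 by rewrite /h wE// ler_norml; lra.
have hm0 : 0 < h `^ mu by rewrite powR_gt0.
have dh0 : 0 < delta * h by rewrite mulr_gt0.
have dh4 : 4 * (delta * h) <= h by rewrite mulrA; apply: ler_piMl; lra.
have dh16 : (2 * (delta * h)) `^ mu <= h `^ mu / 16.
  by rewrite mulrA powRM; [|lra|lra]; rewrite mulrC ler_pM2l.
have [a [a0 a1 /andP[at1 at2] aP]] :=
  almost_constant_window _ _ _ _ _ _ _ (delta * h) met mu0 G0 hb t01 dh0
  (ltac:(lra)).
(* The factor [1 / h] in the bound on the integrand cancels against the window length
   [delta * h]. *)
have cE : delta / (4 `^ p * 2 `^ (mu * p + 1)) * G `^ p =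
   (4 `^ p * 2 `^ (mu * p + 1))^-1 * G `^ p / h ^+ 1 * (delta * h).
  have h3 : (4 : R) `^ p != 0 by rewrite gt_eqF// powR_gt0.
  have h4 : (2 : R) `^ (mu * p + 1) != 0 by rewrite gt_eqF// powR_gt0.
  by field; rewrite h3 h4 gt_eqF.
rewrite cE; apply: (@integral_ge_itv _ _ _ a).
- by rewrite !mulr_ge0 ?invr_ge0 ?exprn_ge0 ?mulr_ge0 ?powR_ge0// ltW.
- exact: ltW.
- by move=> x /=; rewrite !in_itv/=; lra.
- by move=> x _; rewrite lee_fin mulr_ge0// ?invr_ge0 powR_ge0.
- move=> x xa; rewrite lee_fin.
  (* The value at [t] is at least [G * h^mu / 2] and the oscillation at most [G * h^mu / 8]. *)
  have dx : G * h `^ mu / 4 <= dist (f e) (f x).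
    case: met => _ _ dC dT.
    have {}Ge : G / 2 * h `^ mu <= dist (f e) (f t) by rewrite -ler_pdivlMr.
    have := dT (f e) (f x) (f t); have := aP x xa; rewrite (dC (f x)).
    have : G * (2 * (delta * h)) `^ mu <= G * (h `^ mu / 16) by rewrite ler_wpM2l.
    have : 0 <= G * h `^ mu by rewrite mulr_ge0// ltW.
    clear -Ge; lra.
  (* The distance to [e] is 1-Lipschitz and the window has length at most [h / 4]. *)
  have wx : 0 < w x <= 2 * h.
    rewrite wE; last by clear -xa a0 a1; lra.
    have := wE t t01; rewrite -/h => hE.
    have d1 : `|x - t| <= delta * h by rewrite ler_norml; clear -xa at1 at2; lra.
    have := ler_normD (x - t) (t - e); have := ler_normD (t - x) (x - e).
    rewrite (distrC t x) !addrA !subrK -hE.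
    by move=> *; apply/andP; split; lra.
  exact: (powR_ratio_ge _ p mu G h _ (w x) 1 p0 mu0 G0 wt0 wx dx).
Qed.

(** If [y <= x], a common point exists: [t] when [t <= x], and [x] otherwise. *)
Lemma disjoint_intervals_lt (R : realType) (a a' b b' s t x y : R) :
  a <= s <= a' -> b <= t <= b' -> s <= t ->
  (forall z, a <= z <= a' -> b <= z <= b' -> False) ->
  a <= x <= a' -> b <= y <= b' -> x < y.
Proof.
move=> /andP[as1 sa] /andP[bt tb] st disj /andP[ax xa] /andP[bY yb].
rewrite ltNge; apply/negP => yx.
by have [tx|xt] := leP t x; [apply: (disj t)|apply: (disj x)]; lra.
Qed.

(** The product of the windows around [s], [t], [u] has volume [(delta * h) ^+ 3] and lies in the
    domain [s < t < u]; the integrand there is of order at least [G^p / h^3], so the scale [h]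
    disappears. *)
Lemma besov_integral_ge (R : realType) (E : Type) (dist : E -> E -> R)
    (f : R -> E) (p mu delta G s t u : R) :
  is_metric dist -> 0 < p -> 0 < mu -> 0 < G -> holder_bounded R E dist f mu G ->
  0 < delta -> 4 * delta <= 1 -> (2 * delta) `^ mu <= 16^-1 ->
  0 <= s -> s <= t <= u -> s < u -> u <= 1 ->
  G / 2 <= Delta dist f s t u / (u - s) `^ mu ->
  ((delta ^+ 3 / (4 `^ p * 2 `^ (mu * p + 3)) * G `^ p)%:E <=
   \int[@lebesgue_measure R]_(u in `[0%R, 1%R])
   \int[@lebesgue_measure R]_(t in `[0%R, 1%R])
   \int[@lebesgue_measure R]_(s in `[0%R, 1%R])
      (if ((s < t) && (t < u))%R then
         ((Delta dist f s t u) `^ p / (u - s) `^ (mu * p + 3))%:E else 0%E))%E.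
Proof.
move=> met p0 mu0 G0 hb dl0 dl4 dl16 s0 /andP[st tu] su u1 Ge.
set h := u - s in Ge *.
have h0 : 0 < h by rewrite /h; lra.
have h1 : h <= 1 by rewrite /h; lra.
have hm0 : 0 < h `^ mu by rewrite powR_gt0.
have {}Ge : G / 2 * h `^ mu <= Delta dist f s t u by rewrite -ler_pdivlMr.
set eta := delta * h.
have dh0 : 0 < eta by rewrite mulr_gt0.
have dh4 : 4 * eta <= h by rewrite mulrA; apply: ler_piMl; lra.
have dh2 : 2 * eta <= 1 by lra.
have GM : 0 < G * h `^ mu by rewrite mulr_gt0.
have err : 2 * G * (2 * eta) `^ mu <= G * h `^ mu / 8.
  have : (2 * eta) `^ mu <= h `^ mu / 16.
    by rewrite mulrA powRM; [|lra|lra]; rewrite mulrC ler_pM2l.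
  move=> /(ler_wpM2l (ltW G0)); lra.
have window x : 0 <= x <= 1 -> exists a, [/\ 0 <= a, a + eta <= 1, a <= x <= a + eta &
    forall y, a <= y <= a + eta -> dist (f x) (f y) <= G * h `^ mu / 8].
  move=> x01.
  have [a [a0 a1 ax aP]] :=
    almost_constant_window _ _ _ _ _ _ _ eta met mu0 (ltW G0) hb x01 dh0 dh2.
  by exists a; split=> // y /aP /le_trans; apply.
have [a [a0 a1 a_s aP]] := window s (ltac:(lra)).
have [b [b0 b1 bt bP]] := window t (ltac:(lra)).
have [c [c0 c1 cu cP]] := window u (ltac:(lra)).
case: (met) => _ _ dC dT.
(* The windows of s and t (of t and u) cannot meet, hence are ordered as the points. *)
have disj x y z : G / 2 * h `^ mu <= dist (f x) (f y) ->
    dist (f x) (f z) <= G * h `^ mu / 8 ->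
    dist (f y) (f z) <= G * h `^ mu / 8 -> False.
  by have := dT (f x) (f z) (f y); rewrite (dC (f z)); clear -GM; lra.
have [Dst Dtu] : G / 2 * h `^ mu <= dist (f s) (f t) /\
                 G / 2 * h `^ mu <= dist (f t) (f u).
  by move: Ge; rewrite /Delta le_min => /andP[].
have ltst x y : a <= x <= a + eta -> b <= y <= b + eta -> x < y.
  apply: (@disjoint_intervals_lt _ _ _ _ _ s t) => // z za zb.
  exact: disj Dst (aP z za) (bP z zb).
have lttu x y : b <= x <= b + eta -> c <= y <= c + eta -> x < y.
  apply: (@disjoint_intervals_lt _ _ _ _ _ t u) => // z zb zc.
  exact: disj Dtu (bP z zb) (cP z zc).
have sub01 x : 0 <= x -> x + eta <= 1 -> `[x, x + eta]%classic `<=` `[0, 1]%classic.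
  by move=> x0 x1 y /=; rewrite !in_itv/=; clear -x0 x1; lra.
set k := (4 `^ p * 2 `^ (mu * p + 3))^-1 * G `^ p / h ^+ 3.
have k0 : 0 <= k by rewrite !mulr_ge0 ?invr_ge0 ?exprn_ge0 ?mulr_ge0 ?powR_ge0// ltW.
have -> : delta ^+ 3 / (4 `^ p * 2 `^ (mu * p + 3)) * G `^ p = k * eta * eta * eta.
  have h3 : (4 : R) `^ p != 0 by rewrite gt_eqF// powR_gt0.
  have h4 : (2 : R) `^ (mu * p + 3) != 0 by rewrite gt_eqF// powR_gt0.
  by rewrite /k /eta; field; rewrite h3 h4 gt_eqF.
have eta0 := ltW dh0.
have k1 : 0 <= k * eta by exact: mulr_ge0.
have k2 : 0 <= k * eta * eta by exact: mulr_ge0.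
have int0 x y z : (0 <= (if ((z < y) && (y < x))%R then
   ((Delta dist f z y x) `^ p / (x - z) `^ (mu * p + 3))%:E else 0))%E.
  by case: ifP => // _; rewrite lee_fin mulr_ge0 ?invr_ge0 ?powR_ge0.
(* The integrals are bounded from the outermost inwards, each window contributing one factor
   [eta]. *)
apply: (@integral_ge_itv _ _ _ c) => //; first exact: (sub01 c).
  by move=> x _; apply: integral_ge0 => y _; apply: integral_ge0.
move=> u' u'c.
apply: (@integral_ge_itv _ _ _ b) => //; first exact: (sub01 b).
  by move=> y _; apply: integral_ge0.
move=> t' t'b.
apply: (@integral_ge_itv _ _ _ a) => //; first exact: (sub01 a).
move=> s' s'a.
have s't' := ltst _ _ s'a t'b; have t'u' := lttu _ _ t'b u'c.
rewrite s't' t'u'/= lee_fin.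
(* Moving the three points by at most [G * h^mu / 8] each lowers [Delta] from [G * h^mu / 2] by at
   most [G * h^mu / 4]. *)
have D' : G * h `^ mu / 4 <= Delta dist f s' t' u'.
  have := Delta_ge _ _ dist f s t u s' t' u' _ met (aP _ s'a) (bP _ t'b) (cP _ u'c).
  by move: Ge; clear; lra.
(* Each end moves by at most [eta <= h / 4], so the gap stays below [3 * h / 2]. *)
have v' : 0 < u' - s' <= 2 * h.
  rewrite /h in dh4 *.
  by move: s't' t'u' s'a u'c a_s cu dh4; clear; lra.
exact: (powR_ratio_ge _ p mu G h _ (u' - s') 3 p0 mu0 (ltW G0) h0 v' D').
Qed.

(** * Roots of integrals and signs of the seminorms *)

Lemma poweR_root_ge (R : realType) (p K G : R) (I : \bar R) :
  0 < p -> 0 <= K -> 0 <= G -> ((K * G `^ p)%:E <= I)%E ->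
  ((K `^ p^-1 * G)%:E <= I `^ p^-1)%E.
Proof.
move=> p0 K0 G0 KI.
have KG0 : 0 <= K * G `^ p by rewrite mulr_ge0 ?powR_ge0.
have -> : (K `^ p^-1 * G)%:E = ((K * G `^ p)%:E `^ p^-1)%E.
  by rewrite poweR_EFin powRM ?powR_ge0// -powRrM mulfV ?gt_eqF// powRr1.
have pV0 : 0 <= p^-1 by rewrite invr_ge0 ltW.
apply: (gt0_ler_poweR pV0) => //; rewrite in_itv/= leey andbT ?lee_fin//.
by apply: le_trans KI; rewrite lee_fin.
Qed.

Lemma le_holder_mid (R : realType) (E : Type) (dist : E -> E -> R) (f : R -> E)
    (mu s t u : R) : 0 <= s -> s <= t <= u -> s < u -> u <= 1 ->
  ((Delta dist f s t u / (u - s) `^ mu)%:E <= holder_mid dist f mu)%E.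
Proof. by move=> *; apply: ereal_sup_ubound => /=; exists s, t, u; split. Qed.

Lemma le_holder_left (R : realType) (E : Type) (dist : E -> E -> R) (f : R -> E)
    (mu t : R) : 0 < t <= 1 ->
  ((dist (f 0%R) (f t) / t `^ mu)%:E <= holder_left dist f mu)%E.
Proof.
by move=> t01; apply: ereal_sup_ubound => /=; exists t => //=; rewrite in_itv.
Qed.

Lemma le_holder_right (R : realType) (E : Type) (dist : E -> E -> R) (f : R -> E)
    (mu t : R) : 0 <= t < 1 ->
  ((dist (f 1%R) (f t) / (1 - t) `^ mu)%:E <= holder_right dist f mu)%E.
Proof.
by move=> t01; apply: ereal_sup_ubound => /=; exists t => //=; rewrite in_itv.
Qed.

Lemma holder_mid_ge0 (R : realType) (E : Type) (dist : E -> E -> R) (f : R -> E)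
    (mu : R) : (forall x y, 0 <= dist x y) -> (0 <= holder_mid dist f mu)%E.
Proof.
move=> d0; apply: le_trans (le_holder_mid _ _ _ _ _ 0 0 1 _ _ _ _) => //.
  by rewrite lee_fin divr_ge0 ?powR_ge0// le_min !d0.
by rewrite lexx ler01.
Qed.

Lemma holder_left_ge0 (R : realType) (E : Type) (dist : E -> E -> R) (f : R -> E)
    (mu : R) : (forall x y, 0 <= dist x y) -> (0 <= holder_left dist f mu)%E.
Proof.
move=> d0; apply: le_trans (le_holder_left _ _ _ _ _ 1 _).
  by rewrite lee_fin divr_ge0 ?powR_ge0.
by rewrite lexx ltr01.
Qed.

Lemma holder_right_ge0 (R : realType) (E : Type) (dist : E -> E -> R) (f : R -> E)
    (mu : R) : (forall x y, 0 <= dist x y) -> (0 <= holder_right dist f mu)%E.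
Proof.
move=> d0; apply: le_trans (le_holder_right _ _ _ _ _ 0 _).
  by rewrite lee_fin divr_ge0 ?powR_ge0.
by rewrite lexx ltr01.
Qed.

(** * Comparison of the Hölder and Besov seminorms *)

Lemma holder_le_besov (R : realType) (p mu : R) : 0 < p -> 0 < mu ->
  exists2 C : R, 0 < C &
    forall (E : Type) (dist : E -> E -> R) (f : R -> E),
      is_metric dist -> Dmu dist f mu ->
      (holder_mid dist f mu + holder_left dist f mu + holder_right dist f mu
       <= C%:E * (besov_mid dist f mu p + besov_left dist f mu p
                  + besov_right dist f mu p))%E.
Proof.
move=> p0 mu0; have [delta [dl0 dl4 dl16]] := exists_window_scale R mu mu0.
set K := delta ^+ 3 / (4 `^ p * 2 `^ (mu * p + 3)).
have p4 : 0 < (4 : R) `^ p by rewrite powR_gt0.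
have p2 r : 0 < (2 : R) `^ r by rewrite powR_gt0.
have K0 : 0 < K by rewrite divr_gt0 ?mulr_gt0 ?exprn_gt0.
(* The constant of the triple integral is the smaller one, so [K] serves for all three integrals. *)
have K1 : K <= delta / (4 `^ p * 2 `^ (mu * p + 1)).
  apply: ler_pM; rewrite ?invr_ge0 ?exprn_ge0 ?mulr_ge0 ?(ltW dl0) ?(ltW p4) ?(ltW (p2 _))//.
    by rewrite exprS ler_piMr ?(ltW dl0)// expr_le1 ?(ltW dl0)//; lra.
  rewrite lef_pV2 ?posrE ?mulr_gt0//; apply: ler_wpM2l; first exact: ltW.
  by apply: ler_powR; lra.
set kappa := K `^ p^-1.
have kappa0 : 0 < kappa by rewrite powR_gt0.
(* The three seminorms sum to at most [3 * G], and [kappa * G] will be bounded by the Besov sum. *)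
exists (3 / kappa) => [|E dist f met [_ mid_fin left_fin right_fin]].
  by rewrite divr_gt0.
case: (met) => d0 dE _ _.
have dxx x : dist x x = 0 by exact/dE.
have fin (X : \bar R) : (0 <= X)%E -> (X < +oo)%E -> exists2 y : R, X = y%:E & 0 <= y.
  by case: X => [y|//|//]; rewrite lee_fin => y0 _; exists y.
have [a aE a0] := fin _ (holder_mid_ge0 R E dist f mu d0) mid_fin.
have [b bE b0] := fin _ (holder_left_ge0 R E dist f mu d0) left_fin.
have [c cE c0] := fin _ (holder_right_ge0 R E dist f mu d0) right_fin.
rewrite aE bE cE -!EFinD.
pose G := Num.max a (Num.max b c).
have aG : a <= G by rewrite le_max lexx.
have bG : b <= G by rewrite !le_max lexx !orbT.
have cG : c <= G by rewrite !le_max lexx !orbT.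
have G0 : 0 <= G by exact: le_trans aG.
set B := (X in (_ <= _ * X)%E).
suff kG : ((kappa * G)%:E <= B)%E.
  apply: (@le_trans _ _ ((3 / kappa)%:E * (kappa * G)%:E)%E); last first.
    by apply: lee_wpmul2l => //; rewrite lee_fin divr_ge0// ltW.
  by rewrite -EFinM lee_fin mulrA divfK ?gt_eqF//; lra.
have B1 : (0 <= besov_mid dist f mu p)%E by exact: poweR_ge0.
have B2 : (0 <= besov_left dist f mu p)%E by exact: poweR_ge0.
have B3 : (0 <= besov_right dist f mu p)%E by exact: poweR_ge0.
have sum_ge (x y z : \bar R) : (0 <= x)%E -> (0 <= y)%E -> (0 <= z)%E ->
    [/\ (x <= x + y + z)%E, (y <= x + y + z)%E & (z <= x + y + z)%E].
  move=> x0 y0 z0; split; first by rewrite -addeA leeDl// adde_ge0.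
    by rewrite addeAC leeDr// adde_ge0.
  by rewrite leeDr// adde_ge0.
have [BB1 BB2 BB3] : [/\ (besov_mid dist f mu p <= B)%E,
    (besov_left dist f mu p <= B)%E & (besov_right dist f mu p <= B)%E].
  exact: sum_ge.
(* Positivity of [G] is what makes [G / 2 < G], hence provides a point or triple whose quotient
   exceeds [G / 2]. *)
have [G_le0|Gpos] := leP G 0.
  have -> : G = 0 by apply/eqP; rewrite eq_le G_le0.
  by rewrite mulr0; exact: le_trans B1 BB1.
have hb : holder_bounded R E dist f mu G.
  split=> [s t u s0 /andP[st tu] u1|t /andP[t0 t1]|t /andP[t0 t1]].
  - have [su|us] := ltP s u.
      have := le_holder_mid _ _ dist f mu s t u s0 (introT andP (conj st tu)) su u1.
      rewrite aE lee_fin ler_pdivrMr ?powR_gt0 ?subr_gt0// => /le_trans; apply.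
      by rewrite ler_wpM2r ?powR_ge0.
    have -> : t = s by lra.
    by rewrite /Delta dxx ge_min mulr_ge0 ?powR_ge0.
  - have [t_gt0|t_le0] := ltP 0 t; last first.
      have -> : t = 0 by lra.
      by rewrite dxx mulr_ge0 ?powR_ge0.
    have := le_holder_left _ _ dist f mu t (introT andP (conj t_gt0 t1)).
    rewrite bE lee_fin ler_pdivrMr ?powR_gt0// => /le_trans; apply.
    by rewrite ler_wpM2r ?powR_ge0.
  - have [t_lt1|t_ge1] := ltP t 1; last first.
      have -> : t = 1 by lra.
      by rewrite dxx mulr_ge0 ?powR_ge0.
    have := le_holder_right _ _ dist f mu t (introT andP (conj t0 t_lt1)).
    rewrite cE lee_fin ler_pdivrMr ?powR_gt0 ?subr_gt0// => /le_trans; apply.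
    by rewrite ler_wpM2r ?powR_ge0.
have G2 : G / 2 < G by lra.
have KG : ((K * G `^ p)%:E <= (delta / (4 `^ p * 2 `^ (mu * p + 1)) * G `^ p)%:E)%E.
  by rewrite lee_fin ler_wpM2r ?powR_ge0.
have : [\/ G = a, G = b | G = c].
  rewrite /G; case: (leP a (Num.max b c)) => _; last by constructor 1.
  by case: (leP b c) => _; [constructor 3|constructor 2].
case=> [Ga|Gb|Gc].
- have : ((G / 2)%:E < holder_mid dist f mu)%E by rewrite aE -Ga lte_fin.
  move=> /ereal_sup_gt[_ [s [t [u [s0 stu su u1 ->]]]]].
  rewrite lte_fin => /ltW Ge; apply: le_trans BB1.
  apply: poweR_root_ge => //; first exact: ltW.
  exact: (besov_integral_ge _ _ dist f p mu delta G s t u).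
- have : ((G / 2)%:E < holder_left dist f mu)%E by rewrite bE -Gb lte_fin.
  move=> /ereal_sup_gt[y [t]]; rewrite /= in_itv/= => /andP[t0 t1] <-.
  rewrite lte_fin => /ltW Ge; apply: le_trans BB2.
  apply: poweR_root_ge => //; [exact: ltW|apply: le_trans KG _].
  apply: (endpoint_integral_ge _ _ dist f p mu delta G 0 t id) => //.
  + by rewrite lexx ler01.
  + by move=> x /andP[x0 _]; rewrite subr0 ger0_norm.
  + by rewrite (ltW t0).
- have : ((G / 2)%:E < holder_right dist f mu)%E by rewrite cE -Gc lte_fin.
  move=> /ereal_sup_gt[y [t]]; rewrite /= in_itv/= => /andP[t0 t1] <-.
  rewrite lte_fin => /ltW Ge; apply: le_trans BB3.
  apply: poweR_root_ge => //; [exact: ltW|apply: le_trans KG _].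
  apply: (endpoint_integral_ge _ _ dist f p mu delta G 1 t (fun x => 1 - x)) => //.
  + by rewrite lexx ler01.
  + by move=> x /andP[_ x1]; rewrite distrC ger0_norm// subr_ge0.
  + by rewrite t0 (ltW t1).
  + by rewrite subr_gt0.
Qed.

(** * The Euclidean norm *)

Lemma enorm_ge0 (R : realType) (d : nat) (x : 'rV[R]_d) : 0 <= enorm x.
Proof. exact: sqrtr_ge0. Qed.

Lemma enorm_sqr (R : realType) (d : nat) (x : 'rV[R]_d) :
  enorm x ^+ 2 = \sum_(i < d) (x ord0 i) ^+ 2.
Proof. by rewrite sqr_sqrtr// sumr_ge0// => i _; exact: sqr_ge0. Qed.

Lemma enorm_eq0 (R : realType) (d : nat) (x : 'rV[R]_d) : enorm x = 0 -> x = 0.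
Proof.
move=> x0; apply/rowP => i; rewrite mxE; apply/eqP; rewrite -sqrf_eq0; apply/eqP.
apply: (psumr_eq0P (P := xpredT) (F := fun j => x ord0 j ^+ 2)) => //.
  by move=> j _; exact: sqr_ge0.
by rewrite -enorm_sqr x0 expr0n.
Qed.

Lemma enorm_triangle (R : realType) (d : nat) (x y : 'rV[R]_d) :
  enorm (x + y) <= enorm x + enorm y.
Proof.
(* The weights used below divide by both norms, so vanishing norms are settled first. *)
have [/enorm_eq0->|x0] := eqVneq (enorm x) 0.
  by rewrite add0r lerDr enorm_ge0.
have [/enorm_eq0->|y0] := eqVneq (enorm y) 0.
  by rewrite addr0 lerDl enorm_ge0.
set a := enorm x in x0 *; set b := enorm y in y0 *.
have a0 : 0 < a by rewrite lt_neqAle eq_sym x0 enorm_ge0.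
have b0 : 0 < b by rewrite lt_neqAle eq_sym y0 enorm_ge0.
rewrite -(ler_pXn2r (n := 2))// ?nnegrE ?enorm_ge0 ?addr_ge0 ?(ltW a0) ?(ltW b0)//.
(* [(x_i + y_i)^2 <= (1 + b/a) x_i^2 + (1 + a/b) y_i^2], summed over i *)
rewrite enorm_sqr.
apply: (@le_trans _ _ ((1 + b / a) * a ^+ 2 + (1 + a / b) * b ^+ 2)); last first.
  by rewrite le_eqVlt; apply/orP; left; apply/eqP; field; rewrite x0 y0.
rewrite !enorm_sqr !mulr_sumr -big_split/=; apply: ler_sum => i _; rewrite mxE.
rewrite -subr_ge0.
set u := x ord0 i; set v := y ord0 i.
have -> : (1 + b / a) * u ^+ 2 + (1 + a / b) * v ^+ 2 - (u + v) ^+ 2 =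
          (b * u - a * v) ^+ 2 / (a * b) by field; rewrite x0 y0.
by rewrite divr_ge0 ?sqr_ge0// mulr_ge0 ?enorm_ge0.
Qed.

Lemma eucl_dist_metric (R : realType) (d : nat) : is_metric (@eucl_dist R d).
Proof.
split=> [x y|x y|x y|x y z]; rewrite /eucl_dist.
- exact: enorm_ge0.
- split=> [/enorm_eq0/eqP|->]; first by rewrite subr_eq0 => /eqP.
  by rewrite subrr /enorm big1 ?sqrtr0// => i _; rewrite mxE expr0n.
- by congr Num.sqrt; apply: eq_bigr => i _; rewrite !mxE -sqrrN opprB.
- by rewrite -(subrKA y x (- z)); exact: enorm_triangle.
Qed.

(** * The supremum norm and the final constants *)

(** Either [|f 0| <= 2 * L], or [|f t| >= |f 0| - L >= |f 0| / 2] on all of [[0, 1]], and then the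
    [L_p] norm is at least [|f 0| / 2]. One more [L] passes from [f 0] to [f t]. *)
Lemma sup_norm_le (R : realType) (d : nat) (f : R -> 'rV[R]_d) (p L : R) :
  0 < p -> 0 <= L -> (forall t, 0 <= t <= 1 -> eucl_dist (f 0) (f t) <= L) ->
  (sup_norm f <= (3 * L)%:E + 2%:E * Lp_norm f p)%E.
Proof.
move=> p0 L0 fL; have [_ _ dC dT] := eucl_dist_metric R d.
have normE (x : 'rV[R]_d) : enorm x = eucl_dist x 0 by rewrite /eucl_dist subr0.
have Lp0 : (0 <= 2%:E * Lp_norm f p)%E by rewrite mule_ge0// poweR_ge0.
have f0 : ((enorm (f 0%R))%:E <= (2 * L)%:E + 2%:E * Lp_norm f p)%E.
  have [small|big] := leP (enorm (f 0)) (2 * L).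
    by rewrite -[leLHS]adde0 leeD// lee_fin.
  suff /(lee_wpmul2l (x := 2%:E)) : ((enorm (f 0%R) / 2)%:E <= Lp_norm f p)%E.
    rewrite -EFinM mulrC divfK// => /(_ _)/le_trans; apply => //.
    by rewrite leeDr// lee_fin mulr_ge0.
  have := @poweR_root_ge R p 1 (enorm (f 0) / 2)
    (\int[@lebesgue_measure R]_(t in `[0%R, 1%R]) (enorm (f t) `^ p)%:E)%E.
  rewrite powR1 !mul1r; apply => //; first by rewrite divr_ge0 ?enorm_ge0.
  rewrite -[X in (X%:E <= _)%E]mulr1; apply: (@integral_ge_itv _ _ _ 0) => //.
  - exact: powR_ge0.
  - by rewrite add0r.
  - by move=> x _; rewrite lee_fin powR_ge0.
  - rewrite add0r => x x01; rewrite lee_fin.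
    apply: ge0_ler_powR; rewrite ?nnegrE ?divr_ge0 ?enorm_ge0 ?(ltW p0)//.
    by move: (fL x x01) (dT (f 0) (f x) 0) big; rewrite -!normE; clear; lra.
apply: ge_ereal_sup => y [t /=]; rewrite in_itv/= => t01 <-.
apply: (@le_trans _ _ (L%:E + (enorm (f 0%R))%:E)%E).
  rewrite -EFinD lee_fin; have := dT (f t) (f 0) 0; rewrite -!normE (dC (f t)).
  by move=> /le_trans; apply; rewrite lerD2r fL.
apply: (le_trans (leeD (lexx _) f0)); rewrite addeA -EFinD leeD// lee_fin.
by clear; lra.
Qed.

Theorem theorem1 (R : realType) (p mu : R) (hp : 1 < p) (hmu0 : 0 < mu)
    (hmu1 : mu < 1) :
  (forall (E : Type) (dist : E -> E -> R), is_polish dist ->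
     exists2 C : R, 0 < C &
       forall f : R -> E, Dmu dist f mu ->
         (holder_mid dist f mu + holder_left dist f mu + holder_right dist f mu
          <= C%:E * (besov_mid dist f mu p + besov_left dist f mu p
                     + besov_right dist f mu p))%E) /\
  (forall d : nat,
     exists2 C : R, 0 < C &
       forall f : R -> 'rV[R]_d, Dmu eucl_dist f mu ->
         (holder_mid eucl_dist f mu + holder_left eucl_dist f mu
            + holder_right eucl_dist f mu
          <= C%:E * (besov_mid eucl_dist f mu p + besov_left eucl_dist f mu p
                     + besov_right eucl_dist f mu p))%E /\
         (sup_norm f
          <= C%:E * (Lp_norm f p + besov_mid eucl_dist f mu p
                     + besov_left eucl_dist f mu p + besov_right eucl_dist f mu p))%E).
Proof.
have p0 : 0 < p by apply: lt_trans hp.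
have [C C0 CP] := holder_le_besov R p mu p0 hmu0.
split=> [E dist [met _ _]|d]; first by exists C => // f; exact: CP.
have met := eucl_dist_metric R d.
(* With [L] the left seminorm, [3 * L] is at most [3 * C] times the Besov sum, and 2 is the factor
   of the [L_p] norm; the sum also exceeds [C], as the first inequality requires. *)
exists (3 * C + 2) => [|f Df]; first by rewrite addr_gt0// mulr_gt0.
have := CP _ _ f met Df.
rewrite -(addeA (Lp_norm f p)) -(addeA (Lp_norm f p)).
set N := (X in (X <= _)%E); set B := (_ + _ + besov_right _ _ _ _)%E => NB.
have B0 : (0 <= B)%E by rewrite !adde_ge0// poweR_ge0.
split.
  by apply: (le_trans NB); apply: lee_wpmul2r; rewrite // lee_fin; lra.
case: (Df) => _ _ left_fin _; case: (met) => d0 dE _ _.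
have left0 := holder_left_ge0 R _ _ f mu d0.
have leftE : (fine (holder_left eucl_dist f mu))%:E = holder_left eucl_dist f mu.
  by rewrite fineK// ge0_fin_numE.
(* Since [t^mu <= 1] on [[0, 1]], the left seminorm bounds the distance to [f 0]. *)
have osc t : 0 <= t <= 1 -> eucl_dist (f 0) (f t) <= fine (holder_left eucl_dist f mu).
  move=> /andP[t0 t1]; have [t_gt0|t_le0] := ltP 0 t; last first.
    have -> : t = 0 by lra.
    by rewrite (iffRL (dE _ _) erefl) fine_ge0.
  have := le_holder_left _ _ eucl_dist f mu t (introT andP (conj t_gt0 t1)).
  rewrite -leftE lee_fin ler_pdivrMr ?powR_gt0// => /le_trans; apply.
  rewrite ler_piMr ?fine_ge0//; apply: (@le_trans _ _ (1 `^ mu)); last by rewrite powR1.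
  by apply: ge0_ler_powR; rewrite ?nnegrE ?(ltW hmu0).
have leftB : (holder_left eucl_dist f mu <= C%:E * B)%E.
  apply: le_trans NB; rewrite /N -addeA addeCA leeDl//.
  by rewrite adde_ge0 ?holder_mid_ge0 ?holder_right_ge0.
have Lp0 : (0 <= Lp_norm f p)%E by exact: poweR_ge0.
apply: (le_trans (sup_norm_le R d f p _ p0 (fine_ge0 left0) osc)).
rewrite EFinM leftE ge0_muleDr// [leRHS]addeC; apply: leeD.
  apply: (le_trans (lee_wpmul2l _ leftB)); first by rewrite lee_fin.
  by rewrite muleA -EFinM; apply: lee_wpmul2r; rewrite // lee_fin; lra.
by apply: lee_wpmul2r; rewrite // lee_fin; lra.
Qed.
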